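(* Let $e$ be a positive integer, $p$ a prime, $H$ a finite group of order $m$, $F$ the free group on $X=\{x_1,\ldots,x_e\}$, and $\psi\colon F\to H$ an epimorphism with kernel $M$. Let $\Psi\colon F\to W^e$ and $\Psi_p\colon F\to (W_{(p)})^e$ be the homomorphisms defined in the context. Then: (a) $\ker\Psi=M'$ and $\ker\Psi_p=M_p$. (b) The $p$-cover $\hat H_{p,e}=F/M_p$ of $H$ of rank $e$ is isomorphic to $\Psi_p(F)$, and $M/M_p\cong\Psi_p(M)$ as $H$-modules.
   Context: $M'=[M,M]$ is the derived subgroup of $M$, and $M_p=[M,M]M^{[p]}$, where $M^{[p]}$ is the subgroup generated by all $p$-th powers of elements of $M$. The quotient $M/M_p$ is an $H$-module where $g\in H$ acts by conjugation by any $\psi$-preimage of $g$. $W=\mathbb{Z}\wr H=H\ltimes\mathbb{Z}^m$ is the regular wreath product, where the $m$ copies of $\mathbb{Z}$ in $\mathbb{Z}^m$ are labelled by the elements of $H$. For $z\in\mathbb{Z}$, $h\in H$, write $z(h)\in\mathbb{Z}^m$ for the element with $z$ in the position labelled $h$ and $0$ elsewhere. $H$ acts on $\mathbb{Z}^m$ on the right by $1(g)^b=1(gb)$, and the multiplication in $W$ is $(a,u)(b,v)=(ab,u^b+v)$ for $a,b\in H$, $u,v\in\mathbb{Z}^m$. Let $\mathbf{e}$ be the identity of $H$. For $i\in\{1,\ldots,e\}$ let $\psi_i\colon F\to W$ be the homomorphism with $\psi_i(x_j)=(\psi(x_j),0)$ for $j\neq i$ and $\psi_i(x_i)=(\psi(x_i),1(\mathbf{e}))$.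 Put $\Psi=\psi_1\times\cdots\times\psi_e\colon F\to W^e$. Let $W_{(p)}=H\ltimes\mathbb{Z}_p^m$ be the version of $W$ modulo $p$, and let $\Psi_p\colon F\to(W_{(p)})^e$ be the composition of $\Psi$ with the map $W^e\to (W_{(p)})^e$ induced by the natural projection $\mathbb{Z}\to\mathbb{Z}_p$. The group $\Psi_p(M)$ lies in $(\mathbb{Z}_p^m)^e$, and $g\in H$ acts on it by conjugation by $\Psi_p(f)$ for any $f\in F$ with $\psi(f)=g$. *)

(* Defs.v *)
From HB Require Import structures.
From mathcomp Require Import all_boot all_order fingroup all_algebra.
From mathcomp Require Import boolp classical_sets.

Set Implicit Arguments.
Unset Strict Implicit.
Unset Printing Implicit Defensive.

Import GRing.Theory.

Local Open Scope classical_set_scope.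
Local Open Scope quotient_scope.
Local Open Scope group_scope.

Notation "{ 'ghom' G -> H }" := (UMagmaMorphism.type G%type H%type)
  (at level 0, G at level 98, H at level 99, format "{ 'ghom'  G  ->  H }")
  : type_scope.

Section Homs.
Variables (G H : groupType) (f : {ghom G -> H}).

Definition ker : set G := [set x | f x = 1].

End Homs.

Definition surjective (T U : Type) (f : T -> U) := forall y, exists x, f x = y.

Definition isomorphic (G H : groupType) := exists f : {ghom G -> H}, bijective f.

Section Words.
Variable X : choiceType.

(* the letter (x, true) stands for x and (x, false) for x^-1 *)
Definition letter : Type := (X * bool)%type.
HB.instance Definition _ := Choice.on letter.

Definition linv (a : letter) : letter := (a.1, ~~ a.2).

Definition reduced (w : seq letter) := sorted (fun a b => b != linv a) w.

Definition lcons (a : letter) (w : seq letter) : seq letter :=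
  if w is b :: w' then if b == linv a then w' else a :: w else [:: a].

Definition normal_form (w : seq letter) : seq letter := foldr lcons [::] w.

Lemma linvK : involutive linv.
Proof. by case=> x b; rewrite /linv negbK. Qed.

Lemma reduced_lcons a w : reduced w -> reduced (lcons a w).
Proof.
case: w => [//|b w] /= bw; case: ifPn => [_|ab]; first exact: path_sorted bw.
by rewrite /reduced /= ab.
Qed.

Lemma reduced_nf w : reduced (normal_form w).
Proof. by elim: w => //= a w; apply: reduced_lcons. Qed.

Lemma nf_id w : reduced w -> normal_form w = w.
Proof.
elim: w => //= a w IHw aw; rewrite IHw; last exact: path_sorted aw.
by case: w aw {IHw} => [//|b w] /= /andP[/negPf->].
Qed.

Lemma lconsK a w : reduced w -> lcons a (lcons (linv a) w) = w.
Proof.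
case: w => [|b w] /=; first by rewrite eqxx.
rewrite linvK; case: eqVneq => [->|_] /=; last by rewrite eqxx.
by case: w => [//|c w] /= /andP[/negPf->].
Qed.

Lemma reduced_foldr u w : reduced w -> reduced (foldr lcons w u).
Proof. by move=> rw; elim: u => //= a u; apply: reduced_lcons. Qed.

Lemma foldr_nf u w :
  reduced w -> foldr lcons w (normal_form u) = foldr lcons w u.
Proof.
move=> rw; elim: u => //= a u <-; case: (normal_form u) => [//|b s] /=.
by case: eqVneq => [->|//]; rewrite lconsK //; apply: reduced_foldr.
Qed.

Lemma nf_catl u v : normal_form (normal_form u ++ v) = normal_form (u ++ v).
Proof. by rewrite /normal_form !foldr_cat foldr_nf //; apply: reduced_nf. Qed.

Lemma nf_catr u v : normal_form (u ++ normal_form v) = normal_form (u ++ v).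
Proof. by rewrite {1 3}/normal_form !foldr_cat -/(normal_form _) nf_id ?reduced_nf. Qed.

Definition winv (w : seq letter) := rev (map linv w).

Lemma winvK : involutive winv.
Proof. by move=> w; rewrite /winv map_rev revK (mapK linvK). Qed.

Lemma reduced_winv w : reduced w -> reduced (winv w).
Proof.
rewrite /reduced /winv rev_sorted sorted_map; apply: sub_sorted => a b /=.
by rewrite linvK eq_sym.
Qed.

Lemma nf_winv w : normal_form (winv w ++ w) = [::].
Proof.
elim: w => //= a w; rewrite /winv /= rev_cons cat_rcons.
rewrite /normal_form !foldr_cat /= => IHw.
by rewrite -{2}[a]linvK lconsK ?reduced_nf.
Qed.

Definition free_group : Type := {w : seq letter | reduced w}.
HB.instance Definition _ := SubChoice.on free_group.

Definition of_word (w : seq letter) : free_group := exist (fun w => reduced w) _ (reduced_nf w).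

Definition free_one : free_group := of_word [::].
Definition free_mul (u v : free_group) : free_group := of_word (val u ++ val v).
Definition free_inv (u : free_group) : free_group :=
  exist (fun w => reduced w) _ (reduced_winv (valP u)).

Lemma free_mulA : associative free_mul.
Proof. by move=> u v w; apply: val_inj; rewrite /= nf_catl nf_catr catA. Qed.
Lemma free_mul1 : left_id free_one free_mul.
Proof. by move=> u; apply: val_inj; apply: nf_id; apply: valP. Qed.
Lemma free_mulr1 : right_id free_one free_mul.
Proof. by move=> u; apply: val_inj; rewrite /= cats0 nf_id //; apply: valP. Qed.
Lemma free_mulV : left_inverse free_one free_inv free_mul.
Proof. by move=> u; apply: val_inj; apply: nf_winv. Qed.
Lemma free_mulrV : right_inverse free_one free_inv free_mul.
Proof. by move=> u; apply: val_inj; rewrite /= -{1}[val u]winvK nf_winv. Qed.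

HB.instance Definition _ := isGroup.Build free_group
  free_mulA free_mul1 free_mulr1 free_mulV free_mulrV.

Definition free_gen (x : X) : free_group :=
  exist (fun w => reduced w) [:: (x, true)] isT.

Section Lift.
Variables (G : groupType) (f : X -> G).

Definition letter_val (a : letter) : G := if a.2 then f a.1 else (f a.1)^-1.

Definition word_val (w : seq letter) : G := \prod_(a <- w) letter_val a.

Definition free_lift (w : free_group) : G := word_val (val w).

Lemma letter_valV a : letter_val (linv a) = (letter_val a)^-1.
Proof. by case: a => x [] //=; rewrite /letter_val /= invgK. Qed.

Lemma word_val_lcons a w : word_val (lcons a w) = letter_val a * word_val w.
Proof.
rewrite /word_val; case: w => [|b w] /=; first by rewrite big_seq1 big_nil mulg1.
case: eqVneq => [->|_]; rewrite ?big_cons // letter_valV mulVKg //.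
Qed.

Lemma word_val_nf w : word_val (normal_form w) = word_val w.
Proof.
by elim: w => //= a w IHw; rewrite word_val_lcons IHw /word_val big_cons.
Qed.

Lemma free_lift1 : free_lift 1 = 1.
Proof. by rewrite /free_lift /word_val big_nil. Qed.

Lemma free_liftM : {morph free_lift : u v / u * v}.
Proof. by move=> u v; rewrite /free_lift /= word_val_nf /word_val big_cat. Qed.

HB.instance Definition _ :=
  isUMagmaMorphism.Build free_group G free_lift (free_lift1, free_liftM).

Lemma free_lift_gen x : free_lift (free_gen x) = f x.
Proof. by rewrite /free_lift /word_val /= big_seq1. Qed.

End Lift.

Lemma free_val_prod (u : free_group) : u = free_lift free_gen u.
Proof.
apply: val_inj; rewrite /free_lift; case: u => w /= rw.
rewrite -{1}(nf_id rw); elim: w {rw} => [|a w IHw].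
  by rewrite /word_val big_nil.
rewrite /word_val big_cons -/(word_val _ _) /= IHw.
set u := word_val _ _; have ra : reduced [:: a] by [].
suff -> : letter_val free_gen a = exist (fun w => reduced w) [:: a] ra.
  by rewrite /= (nf_id (valP u)).
by apply: val_inj; case: (a) => x [].
Qed.

Lemma free_hom_ext (G : groupType) (f g : {ghom free_group -> G}) :
  (forall x, f (free_gen x) = g (free_gen x)) -> f =1 g.
Proof.
move=> fg u; rewrite (free_val_prod u) /free_lift /word_val !gmulf_prod.
by apply: eq_bigr => -[x []] _; rewrite /letter_val /= ?gmulfV fg.
Qed.

End Words.

Definition is_subgroup (G : groupType) (A : set G) :=
  A 1 /\ forall x y, A x -> A y -> A (x / y).

Record subgroup (G : groupType) := Subgroup {
  sg_set :> set G;
  sg_is_subgroup : is_subgroup sg_set }.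

Section SubgroupType.
Variables (G : groupType) (A : subgroup G).

Lemma sg_closed : group_closed (fun x => x \in (A : set G)).
Proof.
have [A1 AF] := sg_is_subgroup A; split=> [|x y]; rewrite !inE //.
exact: AF.
Qed.

Definition subgroup_type : Type := {x : G | x \in (A : set G)}.
HB.instance Definition _ := SubChoice.on subgroup_type.
HB.instance Definition _ :=
  SubChoice_isSubGroup.Build G _ subgroup_type sg_closed.

Definition subgroup_elt (x : G) (Ax : sg_set A x) : subgroup_type :=
  exist (fun x => x \in (A : set G)) x (mem_set Ax).

Lemma subgroup_valP (u : subgroup_type) : sg_set A (val u).
Proof. exact: set_mem (valP u). Qed.

End SubgroupType.

Section SubgroupConstructions.
Variables (G H : groupType) (f : {ghom G -> H}).

Lemma ker_is_subgroup : is_subgroup (ker f).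
Proof.
split=> [|x y]; rewrite /ker /=; first exact: gmulf1.
by rewrite gmulfF => -> ->; rewrite divgg.
Qed.
Definition ker_subgroup := Subgroup ker_is_subgroup.

Lemma setT_is_subgroup : is_subgroup [set: G].
Proof. by []. Qed.
Definition full_subgroup := Subgroup setT_is_subgroup.

Lemma image_is_subgroup (A : subgroup G) : is_subgroup (f @` A).
Proof.
have [A1 AF] := sg_is_subgroup A; split=> [|x y].
  by exists 1; [|exact: gmulf1].
by move=> [u Au <-] [v Av <-]; exists (u / v); [exact: AF|exact: gmulfF].
Qed.
Definition image_subgroup (A : subgroup G) := Subgroup (image_is_subgroup A).

End SubgroupConstructions.

Record normal_subgroup (G : groupType) := NormalSubgroup {
  ns_subgroup :> subgroup G;
  ns_conj : forall x y, sg_set ns_subgroup x -> sg_set ns_subgroup (x ^ y) }.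

Section Quotient.
Variables (G : groupType) (N : normal_subgroup G).

Definition same_coset : rel G := fun x y => x^-1 * y \in (N : set G).

Let NV x : x \in (N : set G) -> x^-1 \in (N : set G).
Proof. exact: (group_closedV (sg_closed N)). Qed.
Let NM x y : x \in (N : set G) -> y \in (N : set G) -> x * y \in (N : set G).
Proof. exact: (group_closedM (sg_closed N)). Qed.
Let NJ x y : x \in (N : set G) -> x ^ y \in (N : set G).
Proof. by rewrite !inE; apply: ns_conj. Qed.

Lemma same_coset_equiv : equiv_class_of same_coset.
Proof.
split=> [x|x y|y x z]; rewrite /same_coset.
- by rewrite mulVg inE; exact: (sg_is_subgroup N).1.
- by apply/idP/idP => /NV; rewrite invgM invgK.
- by move=> xy yz; have := NM xy yz; rewrite mulgA mulgK.
Qed.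
Canonical same_coset_rel := EquivRelPack same_coset_equiv.

Definition quotient_group : Type := {eq_quot same_coset_rel}.
HB.instance Definition _ := Choice.on quotient_group.

Definition quot_map (x : G) : quotient_group :=
  \pi_({eq_quot same_coset_rel}) x.

Lemma quot_mapP x y : quot_map x = quot_map y <-> sg_set N (x^-1 * y).
Proof.
rewrite /quot_map; split=> [/eqmodP|Nxy]; first by rewrite /= /same_coset inE.
by apply/eqmodP; rewrite /= /same_coset inE.
Qed.

Definition quot_repr (u : quotient_group) : G := 
  @generic_quotient.repr _ {eq_quot same_coset_rel} u.

Lemma quot_reprK : cancel quot_repr quot_map.
Proof. exact: (@generic_quotient.reprK _ {eq_quot same_coset_rel}). Qed.

Definition quot_one : quotient_group := quot_map 1.
Definition quot_mul (u v : quotient_group) := quot_map (quot_repr u * quot_repr v).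
Definition quot_inv (u : quotient_group) := quot_map (quot_repr u)^-1.

Lemma quot_mapM x y : quot_map (x * y) = quot_mul (quot_map x) (quot_map y).
Proof.
apply/quot_mapP; set x' := quot_repr _; set y' := quot_repr _.
have Nx : x^-1 * x' \in (N : set G).
  by rewrite inE; apply/quot_mapP; rewrite quot_reprK.
have Ny : y^-1 * y' \in (N : set G).
  by rewrite inE; apply/quot_mapP; rewrite quot_reprK.
apply: set_mem.
have -> : (x * y)^-1 * (x' * y') = (x^-1 * x') ^ y * (y^-1 * y').
  by rewrite /conjg invgM !mulgA mulgK.
exact: NM (NJ y Nx) Ny.
Qed.

Lemma quot_mapV x : quot_map x^-1 = quot_inv (quot_map x).
Proof.
apply/quot_mapP; set x' := quot_repr _.
have Nx : x^-1 * x' \in (N : set G).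
  by rewrite inE; apply/quot_mapP; rewrite quot_reprK.
apply: set_mem.
have -> : (x^-1)^-1 * x'^-1 = (x^-1 * x')^-1 ^ x^-1.
  by rewrite /conjg invgM !invgK !mulgA mulgK.
exact: NJ (NV Nx).
Qed.

Lemma quot_mulA : associative quot_mul.
Proof.
move=> u v w; rewrite -[u]quot_reprK -[v]quot_reprK -[w]quot_reprK.
by rewrite -!quot_mapM mulgA.
Qed.
Lemma quot_mul1 : left_id quot_one quot_mul.
Proof. by move=> u; rewrite -[u]quot_reprK -quot_mapM mul1g. Qed.
Lemma quot_mulr1 : right_id quot_one quot_mul.
Proof. by move=> u; rewrite -[u]quot_reprK -quot_mapM mulg1. Qed.
Lemma quot_mulV : left_inverse quot_one quot_inv quot_mul.
Proof. by move=> u; rewrite -[u]quot_reprK -quot_mapV -quot_mapM mulVg. Qed.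
Lemma quot_mulrV : right_inverse quot_one quot_inv quot_mul.
Proof. by move=> u; rewrite -[u]quot_reprK -quot_mapV -quot_mapM mulgV. Qed.

HB.instance Definition _ := isGroup.Build quotient_group
  quot_mulA quot_mul1 quot_mulr1 quot_mulV quot_mulrV.

HB.instance Definition _ := isUMagmaMorphism.Build G quotient_group
  quot_map (erefl, quot_mapM).

End Quotient.

Section Generated.
Variable G : groupType.

Definition gen (S : set G) : set G := smallest (@is_subgroup G) S.

Lemma gen_is_subgroup (S : set G) : is_subgroup (gen S).
Proof.
split=> [|x y Sx Sy] A [gA SA]; first exact: gA.1.
by apply: gA.2; [apply: Sx|apply: Sy].
Qed.

Lemma gen_conj (S : set G) :
  (forall x y, S x -> S (x ^ y)) -> forall x y, gen S x -> gen S (x ^ y).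
Proof.
move=> SJ x y Sx; have [g1 gF] := gen_is_subgroup S.
suff : gen S `<=` [set x | gen S (x ^ y)] by exact.
apply: smallest_sub => [|z Sz]; last by apply: sub_gen_smallest; apply: SJ.
split=> [|u v] /=; first by rewrite conj1g.
by move=> Su Sv; rewrite conjMg conjVg; apply: gF.
Qed.

Definition derived (M : set G) : set G :=
  gen [set [~ x, y] | x in M & y in M].

Definition power_subgroup (p : nat) (M : set G) : set G :=
  gen [set x ^+ p | x in M].

Definition derived_power (p : nat) (M : set G) : set G :=
  [set x * y | x in derived M & y in power_subgroup p M].

End Generated.

Section DerivedPower.
Variables (G H : groupType) (f : {ghom G -> H}) (p : nat).
Let M := ker f.

Let MJ x y : M x -> M (x ^ y).
Proof. by rewrite /M /ker /= gmulfJ => ->; rewrite conj1g. Qed.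

Lemma derived_ker_conj x y : derived M x -> derived M (x ^ y).
Proof.
apply: gen_conj => {}x {}y [u Mu [v Mv <-]]; rewrite conjRg.
by exists (u ^ y); [exact: MJ|exists (v ^ y); [exact: MJ|]].
Qed.

Lemma power_ker_conj x y : power_subgroup p M x -> power_subgroup p M (x ^ y).
Proof.
apply: gen_conj => {}x {}y [u Mu <-]; rewrite conjXg.
by exists (u ^ y); first exact: MJ.
Qed.

Lemma derived_power_ker_is_subgroup : is_subgroup (derived_power p M).
Proof.
have [D1 DF] := gen_is_subgroup [set [~ x, y] | x in M & y in M].
have [P1 PF] := gen_is_subgroup [set x ^+ p | x in M].
split=> [|x y]; first by exists 1 => //; exists 1 => //; rewrite mulg1.
move=> [a Da [b Pb <-]] [c Dc [d Pd <-]].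
exists (a / (c ^ (d / b))); first by apply: DF => //; apply: derived_ker_conj.
exists (b / d); first exact: PF.
by rewrite /conjg !invgM !invgK !mulgA !(mulgVK, mulgK).
Qed.

Lemma derived_power_ker_conj x y :
  derived_power p M x -> derived_power p M (x ^ y).
Proof.
move=> [a Da [b Pb <-]]; rewrite conjMg.
exists (a ^ y); first exact: derived_ker_conj.
by exists (b ^ y); first exact: power_ker_conj.
Qed.

Definition derived_power_ker : normal_subgroup G :=
  @NormalSubgroup G (Subgroup derived_power_ker_is_subgroup) derived_power_ker_conj.

End DerivedPower.

(* right H-modules, with the underlying abelian group written multiplicatively *)
Record hmodule (H : groupType) := HModule {
  hm_group :> groupType;
  hm_act : hm_group -> H -> hm_group;
  hm_comm : forall u v : hm_group, u * v = v * u;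
  hm_actM : forall g, {morph hm_act^~ g : u v / u * v};
  hm_act1 : forall u, hm_act u 1 = u;
  hm_act_mul : forall u g h, hm_act u (g * h) = hm_act (hm_act u g) h }.

Definition hmodule_isomorphic (H : groupType) (U V : hmodule H) :=
  exists f : {ghom U -> V},
    bijective f /\ forall u g, f (hm_act u g) = hm_act (f u) g.

(* The group theta(M), for M = ker psi, on which g in H acts as conjugation by
   theta(f) for any psi-preimage f of g; conj_actE states the independence of
   the choice of f. *)
Section ConjModule.
Variables (F H G : groupType) (psi : {ghom F -> H}) (theta : {ghom F -> G}).
Hypothesis psi_surj : surjective psi.
Hypothesis abel : forall x y, ker psi x -> ker psi y ->
  theta x * theta y = theta y * theta x.

Let V := subgroup_type (image_subgroup theta (ker_subgroup psi)).

Definition preimage_of (g : H) : F := projT1 (cid (psi_surj g)).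

Lemma preimage_ofK g : psi (preimage_of g) = g.
Proof. exact: (projT2 (cid (psi_surj g))). Qed.

Lemma conj_act_subproof (u : V) g :
  sg_set (image_subgroup theta (ker_subgroup psi))
    (val u ^ theta (preimage_of g)).
Proof.
have [x Mx <-] := subgroup_valP u.
exists (x ^ preimage_of g); last exact: gmulfJ.
by move: Mx; rewrite /= /ker /= gmulfJ => ->; rewrite conj1g.
Qed.

Definition conj_act (u : V) (g : H) : V :=
  subgroup_elt (conj_act_subproof u g).

Lemma conj_comm (u v : V) : u * v = v * u.
Proof.
apply: val_inj; rewrite !valM.
have [x Mx <-] := subgroup_valP u; have [y My <-] := subgroup_valP v.
exact: abel.
Qed.

Lemma conj_actE (u : V) x : val (conj_act u (psi x)) = val u ^ theta x.
Proof.
rewrite /=; have [y My <-] := subgroup_valP u.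
set z := preimage_of _.
have zx : ker psi (z / x) by rewrite /ker /= gmulfF preimage_ofK divgg.
suff yz : theta y ^ theta (z / x) = theta y.
  by rewrite -{1}(mulgVK x z) gmulfM conjgM yz.
by rewrite /conjg (abel My zx) mulKg.
Qed.

Lemma conj_actM g : {morph conj_act^~ g : u v / u * v}.
Proof.
move=> u v; apply: val_inj; rewrite valM -(preimage_ofK g) !conj_actE.
by rewrite valM conjMg.
Qed.
Lemma conj_act1 u : conj_act u 1 = u.
Proof. by apply: val_inj; rewrite -[X in conj_act _ X](gmulf1 (s := psi)) conj_actE gmulf1 conjg1. Qed.
Lemma conj_act_mul u g h : conj_act u (g * h) = conj_act (conj_act u g) h.
Proof.
apply: val_inj; rewrite -(preimage_ofK g) -(preimage_ofK h) -gmulfM !conj_actE.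
by rewrite gmulfM conjgM.
Qed.

Definition conj_module : hmodule H :=
  HModule conj_comm conj_actM conj_act1 conj_act_mul.

End ConjModule.

Section Wreath.
Variables (H : finGroupType) (A : zmodType).

(* (a, u) is an element of H |x A^m, where m = #|H| and A^m is the group of
   families of elements of A labelled by H *)
Definition wreath : Type := (H * {ffun H -> A})%type.
HB.instance Definition _ := Choice.on wreath.

Definition base_elt (z : A) (h : H) : {ffun H -> A} :=
  [ffun k => if k == h then z else 0%R].

Definition base_act (u : {ffun H -> A}) (b : H) : {ffun H -> A} :=
  [ffun h => u (h * b^-1)].

Lemma base_act_elt z g b : base_act (base_elt z g) b = base_elt z (g * b).
Proof. by apply/ffunP => h; rewrite !ffunE (can2_eq (mulgVK b) (mulgK b)). Qed.

Lemma base_actD u v b : base_act (u + v)%R b = (base_act u b + base_act v b)%R.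
Proof. by apply/ffunP => h; rewrite !ffunE. Qed.
Lemma base_actM u a b : base_act u (a * b) = base_act (base_act u a) b.
Proof. by apply/ffunP => h; rewrite !ffunE invgM mulgA. Qed.
Lemma base_act1 u : base_act u 1 = u.
Proof. by apply/ffunP => h; rewrite !ffunE invg1 mulg1. Qed.
Lemma base_act0 b : base_act 0%R b = 0%R.
Proof. by apply/ffunP => h; rewrite !ffunE. Qed.
Lemma base_actN u b : base_act (- u)%R b = (- base_act u b)%R.
Proof. by apply/ffunP => h; rewrite !ffunE. Qed.

Definition wreath_one : wreath := (1, 0%R).
Definition wreath_mul (x y : wreath) : wreath :=
  (x.1 * y.1, (base_act x.2 y.1 + y.2)%R).
Definition wreath_inv (x : wreath) : wreath :=
  (x.1^-1, (- base_act x.2 x.1^-1)%R).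

Lemma wreath_mulA : associative wreath_mul.
Proof.
by move=> x y z; rewrite /wreath_mul /= mulgA base_actD -base_actM addrA.
Qed.
Lemma wreath_mul1 : left_id wreath_one wreath_mul.
Proof. by case=> a u; rewrite /wreath_mul /= mul1g base_act0 add0r. Qed.
Lemma wreath_mulr1 : right_id wreath_one wreath_mul.
Proof. by case=> a u; rewrite /wreath_mul /= mulg1 base_act1 addr0. Qed.
Lemma wreath_mulV : left_inverse wreath_one wreath_inv wreath_mul.
Proof.
case=> a u; rewrite /wreath_mul /= mulVg base_actN -base_actM mulVg.
by rewrite base_act1 addNr.
Qed.
Lemma wreath_mulrV : right_inverse wreath_one wreath_inv wreath_mul.
Proof. by case=> a u; rewrite /wreath_mul /= mulgV addrN. Qed.

HB.instance Definition _ := isGroup.Build wreath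
  wreath_mulA wreath_mul1 wreath_mulr1 wreath_mulV wreath_mulrV.

End Wreath.

(* the map (Z wr H)^e -> (Z_p wr H)^e induced by the projection Z -> Z_p *)
Section Reduction.
Variables (H : finGroupType) (p e : nat).

Definition wreath_mod (x : wreath H int) : wreath H 'Z_p :=
  (x.1, [ffun h => ((x.2 h)%:~R)%R]).

Definition wreath_mod_pow (x : {ffun 'I_e -> wreath H int}) :
  {ffun 'I_e -> wreath H 'Z_p} := [ffun i => wreath_mod (x i)].

Lemma wreath_modM : {morph wreath_mod : x y / x * y}.
Proof.
move=> x y; congr pair; apply/ffunP => h; rewrite !ffunE /=.
by rewrite rmorphD.
Qed.

Lemma wreath_mod_powM : {morph wreath_mod_pow : x y / x * y}.
Proof. by move=> x y; apply/ffunP => i; rewrite !ffunE wreath_modM. Qed.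

Lemma wreath_mod_pow1 : wreath_mod_pow 1 = 1.
Proof.
apply/ffunP => i; rewrite !ffunE /wreath_mod /=; congr pair.
by apply/ffunP => h; rewrite !ffunE.
Qed.

HB.instance Definition _ := isUMagmaMorphism.Build _ _ wreath_mod_pow
  (wreath_mod_pow1, wreath_mod_powM).

End Reduction.

Section Psi.
Variables (e : nat) (H : finGroupType) (psi : {ghom free_group 'I_e -> H}).

Definition psi_ (i : 'I_e) : {ghom free_group 'I_e -> wreath H int} :=
  free_lift (fun j : 'I_e =>
    (psi (free_gen j), if j == i then base_elt 1%R 1 else 0%R) : wreath H int).

Definition Psi (w : free_group 'I_e) : {ffun 'I_e -> wreath H int} :=
  [ffun i => psi_ i w].

Lemma PsiM : {morph Psi : u v / u * v}.
Proof. by move=> u v; apply/ffunP => i; rewrite !ffunE gmulfM. Qed.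
Lemma Psi1 : Psi 1 = 1.
Proof. by apply/ffunP => i; rewrite !ffunE gmulf1. Qed.
HB.instance Definition _ := isUMagmaMorphism.Build _ _ Psi (Psi1, PsiM).

Lemma psi_fst i w : (psi_ i w).1 = psi w.
Proof.
have m1 : (fst \o psi_ i) 1 = 1 by rewrite /= gmulf1.
have mM : {morph fst \o psi_ i : u v / u * v} by move=> u v /=; rewrite gmulfM.
pose phi : {ghom _ -> _} := HB.pack (fst \o psi_ i)
  (isUMagmaMorphism.Build _ _ (fst \o psi_ i) (m1, mM)).
by apply: (@free_hom_ext _ _ phi psi _ w) => x; rewrite /= free_lift_gen.
Qed.

Variable p : nat.

Definition Psi_mod : {ghom free_group 'I_e -> {ffun 'I_e -> wreath H 'Z_p}} :=
  @wreath_mod_pow H p e \o Psi.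

Lemma Psi_mod_abel x y : ker psi x -> ker psi y ->
  Psi_mod x * Psi_mod y = Psi_mod y * Psi_mod x.
Proof.
move=> Mx My; apply/ffunP => i; rewrite !ffunE /wreath_mod.
move: (psi_fst i x) (psi_fst i y); rewrite Mx My.
case: (psi_ i x) (psi_ i y) => [a u] [b v] /= -> ->.
by congr pair; rewrite /= ?base_act1 // addrC.
Qed.

Definition p_cover : groupType := quotient_group (derived_power_ker psi p).

Definition p_cover_map : {ghom free_group 'I_e -> p_cover} :=
  quot_map (derived_power_ker psi p).

Lemma p_cover_map_abel x y : ker psi x -> ker psi y ->
  p_cover_map x * p_cover_map y = p_cover_map y * p_cover_map x.
Proof.
move=> Mx My; rewrite -!gmulfM; apply/quot_mapP.
exists [~ y, x].
  by apply: sub_gen_smallest; exists y => //; exists x.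
exists 1; last by rewrite mulg1 invgM /commg /conjg !mulgA.
by have [] := gen_is_subgroup [set z ^+ p | z in ker psi].
Qed.

Hypothesis psi_surj : surjective psi.

(* the image of M = ker psi in F / M_p is M / M_p *)
Definition p_cover_module : hmodule H := conj_module psi_surj p_cover_map_abel.

Definition Psi_mod_module : hmodule H := conj_module psi_surj Psi_mod_abel.

End Psi.

(* Main.v *)
(** Choose a section [t] of [psi] and let [theta] be a homomorphism of [F] that
    is abelian on [M].  The elements [theta ((t (psi w * h))^-1 * w * t h)] of
    [theta(M)] form a crossed homomorphism in [w], hence are determined by
    their values at the generators; the multiplicity of the value at
    [(x_i, k * h)] is the entry of [psi_i w] labelled [k].  So if these entries
    vanish and [psi w = 1], then [theta] kills a conjugate of [w], hence [w];
    it is enough that the entries are divisible by [n] if [theta(M)] has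
    exponent [n].  Taking [F / M_n] for [theta] with [n = p], and with [n = 0],
    where [M_0 = M'], gives both kernels. *)
From HB Require Import structures.
Require Import Defs.
From mathcomp Require Import all_boot all_order fingroup all_algebra.
From mathcomp Require Import boolp classical_sets.

Set Implicit Arguments.
Unset Strict Implicit.
Unset Printing Implicit Defensive.

Import GRing.Theory.
Local Open Scope classical_set_scope.
Local Open Scope group_scope.

(** The commutativity proof is a parameter, so that instance inference finds it; sums and integer
    multiples then make sense in [theta(M)]. *)
Definition additive_of (G : groupType) (mulC : forall x y : G, x * y = y * x) : Type := G.

Section AdditiveOf.
Variables (G : groupType) (mulC : forall x y : G, x * y = y * x).

HB.instance Definition _ := Choice.on (additive_of mulC).
HB.instance Definition _ :=
  GRing.isZmodule.Build (additive_of mulC) (@mulgA _) mulC (@mul1g _) (@mulVg _).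

Lemma additive_ofMn (x : additive_of mulC) n : (x *+ n)%R = (x : G) ^+ n.
Proof. by elim: n => // n IHn; rewrite mulrS IHn expgS. Qed.

End AdditiveOf.

Lemma free_group_ind (X : choiceType) (P : free_group X -> Prop) :
    P 1 -> (forall u v, P u -> P v -> P (u * v)) ->
    (forall u, P u -> P u^-1) -> (forall x, P (free_gen x)) ->
  forall w, P w.
Proof.
move=> P1 PM PV PX w; rewrite (free_val_prod w) /free_lift /word_val.
by apply: big_ind => // -[x []] _; rewrite /letter_val /=; [|apply: PV].
Qed.

(** * Crossed homomorphisms on the free group and Fox calculus *)

Section FoxFormula.
Variables (e : nat) (H : finGroupType) (psi : {ghom free_group 'I_e -> H}).
Local Notation F := (free_group 'I_e).

Lemma psi_M i u v :
  (psi_ psi i (u * v)).2 = (base_act (psi_ psi i u).2 (psi v) + (psi_ psi i v).2)%R.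
Proof. by rewrite gmulfM -(psi_fst psi i v). Qed.

Variables (A : zmodType) (D : F -> H -> A).
Hypothesis DM : forall u v h, D (u * v) h = (D u (psi v * h)%g + D v h)%R.

Let fox w h : A :=
  (\sum_i \sum_k D (free_gen i) (k * h)%g *~ (psi_ psi i w).2 k)%R.

Let foxM u v h : fox (u * v) h = (fox u (psi v * h)%g + fox v h)%R.
Proof.
rewrite /fox -big_split; apply: eq_bigr => i _ /=.
under eq_bigr => k _ do rewrite psi_M !ffunE mulrzDr.
rewrite big_split; congr (_ + _)%R.
(* [base_act] shifts labels by [psi v]; substituting [k * psi v] for [k] moves the shift to the
   argument of [D]. *)
rewrite (reindex_inj (mulIg (psi v))); apply: eq_bigr => k _ /=.
by rewrite mulgK mulgA.
Qed.

Let crossed1 (E : F -> H -> A) :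
  (forall u v h, E (u * v) h = (E u (psi v * h)%g + E v h)%R) ->
  forall h, E 1 h = 0%R.
Proof.
move=> EM h; have := EM 1 1 h.
by rewrite mulg1 gmulf1 mul1g -[LHS]addr0 => /addrI.
Qed.

(** The entries of [psi_ psi i w] are the coefficients of a Fox derivative of [w]. Both sides obey
    the rule [DM], so only generators need computing. *)
Lemma fox_formula w h :
  D w h = (\sum_i \sum_k D (free_gen i) (k * h)%g *~ (psi_ psi i w).2 k)%R.
Proof.
rewrite -/(fox w h); elim/free_group_ind: w h => [h|u v IHu IHv h|u IHu h|j h].
- by rewrite !crossed1.
- by rewrite DM foxM IHu IHv.
(* The added term turns both sides into values at [u * u^-1 = 1], which vanish. *)
- apply: (@addrI _ (D u (psi u^-1 * h)%g)); rewrite -DM {1}IHu -foxM mulgV.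
  by rewrite !crossed1.
- rewrite /fox (bigD1 j) //= [X in (_ + X)%R]big1 ?addr0 => [|i ij].
    rewrite (bigD1 (1 : H)) //= big1 ?addr0 => [|k k1].
      by rewrite free_lift_gen /= eqxx ffunE eqxx mul1g.
    by rewrite free_lift_gen /= eqxx ffunE (negPf k1) mulr0z.
  rewrite big1 // => k _.
  by rewrite free_lift_gen /= eq_sym (negPf ij) ffunE mulr0z.
Qed.

End FoxFormula.

(** * An upper bound for kernels of maps abelian on [M] *)

Section KernelUpperBound.
Variables (e : nat) (H : finGroupType) (psi : {ghom free_group 'I_e -> H}).
Variables (G : groupType) (theta : {ghom free_group 'I_e -> G}).
Local Notation F := (free_group 'I_e).
Hypothesis psi_surj : surjective psi.
Hypothesis abel : forall x y, ker psi x -> ker psi y ->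
  theta x * theta y = theta y * theta x.

Let t := preimage_of psi_surj.
Let V := subgroup_type (image_subgroup theta (ker_subgroup psi)).
Let A := additive_of (conj_comm abel).

(** Read from right to left in the Cayley graph of [H], this goes from [1] to [h], along [w] to
    [psi w * h], and back to [1]. *)
Let loop (w : F) h := (t (psi w * h))^-1 * w * t h.

Let loop_ker w h : sg_set (image_subgroup theta (ker_subgroup psi)) (theta (loop w h)).
Proof.
exists (loop w h) => //.
by rewrite /= /ker /= !gmulfM gmulfV !preimage_ofK -mulgA mulVg.
Qed.

Let D w h : A := subgroup_elt (loop_ker w h).

Let DM u v h : D (u * v) h = (D u (psi v * h)%g + D v h)%R.
Proof.
apply: val_inj; rewrite /= -gmulfM; congr (theta _).
by rewrite /loop gmulfM !mulgA mulgK.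
Qed.

Lemma hom_kernel (n : nat) (w : F) :
    (forall x, ker psi x -> theta x ^+ n = 1) ->
    psi w = 1 -> (forall i k, exists c, ((psi_ psi i w).2 k = c *+ n)%R) ->
  theta w = 1.
Proof.
move=> expn psiw un.
have An (a : A) : (a *+ n = 0)%R.
  rewrite additive_ofMn; apply: val_inj; rewrite gmulfXn /=.
  by have [x Mx /= <-] := subgroup_valP (a : V); rewrite expn.
have : D w 1 = 0%R.
  rewrite (fox_formula DM) big1 // => i _; rewrite big1 // => k _.
  by have [c ->] := un i k; rewrite -mulr_natr natz mulrzA -pmulrn An.
(* [t 1] need not be trivial, so the value at [1] is only a conjugate of [theta w]. *)
move/(congr1 val); rewrite /= /loop psiw mulg1 -mulgA -/(conjg _ _) gmulfJ.
by move/eqP; rewrite conjg_eq1 => /eqP.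
Qed.

End KernelUpperBound.

(** * Elementary facts on commutators, powers and kernels *)

Section Kernels.
Variables (F H G : groupType) (psi : {ghom F -> H}) (theta : {ghom F -> G}).

Lemma derived_sub_ker x :
    (forall u v, ker psi u -> ker psi v -> theta u * theta v = theta v * theta u) ->
  derived (ker psi) x -> theta x = 1.
Proof.
move=> abel Dx; apply: (Dx (ker theta)); split; first exact: ker_is_subgroup.
move=> _ [u Mu [v Mv <-]].
by rewrite /ker /= gmulfR; apply/eqP/commgP; apply: abel.
Qed.

Lemma power_sub_ker p x :
    (forall u, ker psi u -> theta u ^+ p = 1) ->
  power_subgroup p (ker psi) x -> theta x = 1.
Proof.
move=> expp Px; apply: (Px (ker theta)); split; first exact: ker_is_subgroup.
by move=> _ [u Mu <-]; rewrite /ker /= gmulfXn; apply: expp.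
Qed.

End Kernels.

(** Zeroth powers are trivial; this lets the exponent [0] stand for the integral case. *)
Lemma derived_power0 (G : groupType) (M : set G) :
  derived_power 0 M `<=` derived M.
Proof.
move=> _ [x Dx [y Py <-]]; suff -> : y = 1 by rewrite mulg1.
apply: (Py [set 1]); split=> [|_ [z _ <-] //].
by split=> // u v /= -> ->; rewrite divgg.
Qed.

Lemma ker_quot_map (G : groupType) (N : normal_subgroup G) x :
  quot_map N x = 1 <-> sg_set N x.
Proof.
split=> [/esym/quot_mapP|Nx]; first by rewrite invg1 mul1g.
by apply/esym/quot_mapP; rewrite invg1 mul1g.
Qed.

Lemma wreath_expn (H : finGroupType) (A : zmodType) (u : {ffun H -> A}) n :
  ((1, u) : wreath H A) ^+ n = (1, (u *+ n)%R).
Proof.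
elim: n => [//|n IHn]; rewrite expgS IHn.
by congr pair; rewrite /= ?mul1g // base_act1 mulrS.
Qed.

Lemma Zp_intr_eq0 p (n : int) :
  prime p -> (n%:~R == 0 :> 'Z_p)%R = (p %| n)%Z.
Proof.
move=> p_prime; rewrite (@dvdz_pcharf 'Z_p p) // inE p_prime pchar_Zp //.
by rewrite prime_gt1.
Qed.

(** * The kernels of [Psi] and its reduction mod [p] *)

Section MagnusEmbedding.
Variables (e : nat) (H : finGroupType) (psi : {ghom free_group 'I_e -> H}).
Hypothesis psi_surj : surjective psi.
Local Notation M := (ker psi).

Lemma psi_pairE i w : psi_ psi i w = (psi w, (psi_ psi i w).2).
Proof. by rewrite -(psi_fst psi i); case: (psi_ _ _ _). Qed.

Lemma Psi_abel x y : M x -> M y -> Psi psi x * Psi psi y = Psi psi y * Psi psi x.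
Proof.
move=> Mx My; apply/ffunP => i; rewrite !ffunE (psi_pairE i x) (psi_pairE i y) Mx My.
by congr pair; rewrite /= !base_act1 addrC.
Qed.

Lemma Psi_mod_expn p x : prime p -> M x -> Psi_mod psi p x ^+ p = 1.
Proof.
move=> p_prime Mx; rewrite -gmulfXn; apply/ffunP => i; rewrite !ffunE gmulfXn.
rewrite psi_pairE Mx wreath_expn; congr pair; apply/ffunP => h; rewrite !ffunE.
by apply/eqP; rewrite Zp_intr_eq0 // ffunMnE -mulr_natr natz; apply: dvdz_mull.
Qed.

Lemma p_cover_map_expn p x : M x -> p_cover_map psi p x ^+ p = 1.
Proof.
move=> Mx; rewrite -gmulfXn; apply/ker_quot_map.
exists 1; first by have [] := gen_is_subgroup [set [~ u, v] | u in M & v in M].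
by exists (x ^+ p); [apply: sub_gen_smallest; exists x | rewrite mul1g].
Qed.

(** The hard inclusion for both kernels at once: [hom_kernel] applied to the projection onto
    [F / M_n]. *)
Lemma derived_power_kerP n w :
    M w -> (forall i k, exists c, ((psi_ psi i w).2 k = c *+ n)%R) ->
  derived_power n M w.
Proof.
move=> Mw un; apply/(ker_quot_map (derived_power_ker psi n)).
apply: (hom_kernel psi_surj (@p_cover_map_abel _ _ psi n)) Mw un.
exact: p_cover_map_expn.
Qed.

Lemma ker_Psi : (0 < e)%N -> ker (Psi psi) = derived M.
Proof.
move=> e_gt0; apply/seteqP; split=> w; last first.
  by apply: derived_sub_ker; apply: Psi_abel.
move=> /ffunP Pw; apply: derived_power0; apply: derived_power_kerP => [|i k].
  (* Reading off [psi w = 1] takes a coordinate of [Psi], hence [0 < e]. *)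
  by have := Pw (Ordinal e_gt0); rewrite !ffunE psi_pairE => -[].
by exists 0%R; have := Pw i; rewrite !ffunE => ->; rewrite ffunE.
Qed.

Lemma ker_Psi_mod p :
  (0 < e)%N -> prime p -> ker (Psi_mod psi p) = derived_power p M.
Proof.
move=> e_gt0 p_prime; apply/seteqP; split=> w; last first.
  move=> [x Dx [y Py <-]]; rewrite /ker /mkset gmulfM.
  rewrite (derived_sub_ker (@Psi_mod_abel _ _ psi p) Dx).
  by rewrite (power_sub_ker _ Py) ?mulg1 // => u; apply: Psi_mod_expn.
move=> /ffunP Pw; apply: derived_power_kerP => [|i k].
  by have := Pw (Ordinal e_gt0); rewrite !ffunE psi_pairE => -[].
(* Vanishing in ['Z_p] means divisibility by [p]; the quotient is the required [c]. *)
have := Pw i; rewrite !ffunE => -[_ /ffunP/(_ k)]; rewrite !ffunE => /eqP.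
by rewrite Zp_intr_eq0 // => /dvdzP[c uE]; exists c; rewrite -mulr_natr natz.
Qed.

End MagnusEmbedding.

(** * Images of one group under maps with equal kernels *)

Section IsoOfKernels.
Variables (T G1 G2 : groupType) (a1 : {ghom T -> G1}) (a2 : {ghom T -> G2}).
Hypothesis a1_surj : surjective a1.
Hypothesis a2_surj : surjective a2.
Hypothesis eq_ker : forall x, a1 x = 1 <-> a2 x = 1.

(** Both groups are [T] modulo the same kernel. The equation for [f] is kept because equivariance is
    checked through it. *)
Lemma iso_of_kernels :
  exists f : {ghom G1 -> G2}, bijective f /\ forall x, f (a1 x) = a2 x.
Proof.
have [s1 s1K] := choice a1_surj; have [s2 s2K] := choice a2_surj.
have eqa x y : a1 x = a1 y <-> a2 x = a2 y.
  split=> E; apply: divg1_eq; rewrite -gmulfF.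
    by apply/eq_ker; rewrite gmulfF E divgg.
  by apply/eq_ker; rewrite gmulfF E divgg.
pose f u := a2 (s1 u).
have fE x : f (a1 x) = a2 x by apply/eqa; rewrite s1K.
have f1 : f 1 = 1 by rewrite -(gmulf1 (s := a1)) fE gmulf1.
have fM : {morph f : u v / u * v}.
  by move=> u v; rewrite -{1}(s1K u) -{1}(s1K v) -gmulfM fE gmulfM.
pose phi : {ghom G1 -> G2} := HB.pack f (isUMagmaMorphism.Build _ _ f (f1, fM)).
exists phi; split=> //; exists (a1 \o s2) => u /=; last by rewrite fE s2K.
by rewrite -[RHS]s1K; apply/eqa; rewrite s2K.
Qed.

End IsoOfKernels.

(** * Restriction to a subgroup and the action on its image *)

Section Corestriction.
Variables (F G : groupType) (theta : {ghom F -> G}) (B : subgroup F).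

(** Cutting the target down to the image gives the surjectivity that [iso_of_kernels] requires. *)
Definition corestrict (x : subgroup_type B) :
    subgroup_type (image_subgroup theta B) :=
  subgroup_elt (imageP theta (subgroup_valP x) : sg_set (image_subgroup _ _) _).

Lemma corestrict1 : corestrict 1 = 1.
Proof. by apply: val_inj; rewrite /= gmulf1. Qed.

Lemma corestrictM : {morph corestrict : x y / x * y}.
Proof. by move=> x y; apply: val_inj; rewrite /= gmulfM. Qed.

HB.instance Definition _ := isUMagmaMorphism.Build _ _ corestrict
  (corestrict1, corestrictM).

Lemma corestrict_surj : surjective corestrict.
Proof.
move=> u; have [x Bx xu] := subgroup_valP u.
by exists (subgroup_elt Bx); apply: val_inj.
Qed.

Lemma corestrict_eq1 x : corestrict x = 1 <-> theta (val x) = 1.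
Proof. by split=> [/(congr1 val)|E] //; apply: val_inj. Qed.

End Corestriction.

(** The action on [theta(M)] is induced by conjugation inside [M], which does not depend on [theta];
    this makes an isomorphism compatible with the corestrictions equivariant. *)
Lemma conj_act_corestrict (F H G : groupType) (psi : {ghom F -> H})
    (theta : {ghom F -> G}) (psi_surj : surjective psi)
    (x : subgroup_type (ker_subgroup psi)) y
    (My : sg_set (ker_subgroup psi) (val x ^ y)) :
    (forall u v, ker psi u -> ker psi v -> theta u * theta v = theta v * theta u) ->
  conj_act psi_surj (corestrict theta x) (psi y) =
  corestrict theta (subgroup_elt My).
Proof.
by move=> abel; apply: val_inj; rewrite conj_actE //; apply/esym/gmulfJ.
Qed.

Theorem theorem3p7 (e p : nat) (H : finGroupType)
    (psi : {ghom free_group 'I_e -> H})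
    (e_gt0 : (0 < e)%N) (p_prime : prime p) (psi_surj : surjective psi) :
  let M := ker psi in
  (ker (Psi psi) = derived M /\ ker (Psi_mod psi p) = derived_power p M) /\
  (isomorphic (p_cover psi p)
     (subgroup_type (image_subgroup (Psi_mod psi p) (full_subgroup _))) /\
   hmodule_isomorphic (p_cover_module p psi_surj) (Psi_mod_module p psi_surj)).
Proof.
move=> M; have kerP := ker_Psi_mod psi_surj e_gt0 p_prime.
have coverP x : p_cover_map psi p x = 1 <-> Psi_mod psi p x = 1.
  by apply: (iff_trans (ker_quot_map _ x)); rewrite -[_ = 1]/(ker _ x) kerP.
split; first by split=> //; apply: ker_Psi.
split.
  (* [F] is replaced by its full subgroup to give [pi] and [corestrict] the same source. *)
  pose B : subgroup (free_group 'I_e) := full_subgroup _.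
  pose pi : {ghom subgroup_type B -> p_cover psi p} := p_cover_map psi p \o val.
  have pi_surj : surjective pi.
    move=> u; exists (subgroup_elt (I : sg_set B (quot_repr u))).
    exact: quot_reprK.
  have eq_ker x : pi x = 1 <-> corestrict (Psi_mod psi p) x = 1.
    by rewrite corestrict_eq1; apply: coverP.
  have [f [f_bij _]] := iso_of_kernels pi_surj (@corestrict_surj _ _ _ _) eq_ker.
  by exists f.
pose B := ker_subgroup psi.
have eq_ker (x : subgroup_type B) :
    corestrict (p_cover_map psi p) x = 1 <-> corestrict (Psi_mod psi p) x = 1.
  by rewrite !corestrict_eq1; apply: coverP.
have [f [f_bij fE]] := iso_of_kernels
  (@corestrict_surj _ _ _ _) (@corestrict_surj _ _ _ _) eq_ker.
exists f; split=> // u g.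
(* Preimages of [u] and [g] reduce equivariance to conjugating [x] by [y]. *)
have [x <-] := corestrict_surj u; rewrite fE.
have [y <-] := psi_surj g.
have My : sg_set (ker_subgroup psi) (val x ^ y).
  by have := subgroup_valP x; rewrite /= /ker /= gmulfJ => ->; rewrite conj1g.
transitivity (f (corestrict (p_cover_map psi p) (subgroup_elt My))).
  congr (f _); apply: conj_act_corestrict; exact: p_cover_map_abel.
by rewrite fE; apply/esym/conj_act_corestrict/Psi_mod_abel.
Qed.
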